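(* Let $N\ge 2$ and $n\ge 1$ be integers, let $h>0$ and let $\vec J=(J_1,\dots,J_n)$ with $J_i>0$ for all $i$. Consider the Hamiltonian $\mathcal H$ on $\Omega=\{-1,+1\}^{\Lambda_N^n}$ described in the context. Suppose that $\vec J$ is monotone, i.e. either $J_1\ge J_2\ge\dots\ge J_n$ or $J_1\le J_2\le\dots\le J_n$, and that $$\Big(1-\frac1N\Big)\sum_{i=1}^n J_iN^i>h .$$ Then $\Omega_{\mathrm{meta}}=\{\boxminus\}$.
   Context: The hierarchical lattice $\Lambda_N^n=\{1,2,\dots,N^n\}$; the integer $a$ is identified with a vertex $v_a$. For $0\le k\le n$, the sets $\{jN^k+1,\dots,(j+1)N^k\}$, $0\le j<N^{n-k}$, are the $k$-blocks. The hierarchical distance $d(a,b)$ is the smallest $k\ge 0$ such that $a$ and $b$ lie in a common $k$-block. A configuration $\sigma\in\Omega=\{-1,+1\}^{\Lambda_N^n}$ is identified with the set $\{v:\sigma(v)=+1\}$; $\boxminus\equiv -1$, $\boxplus\equiv+1$. The Hamiltonian is $$\mathcal H(\sigma)=-\frac12\sum_{\{v,w\}:\,v\neq w}J_{d(v,w)}\sigma(v)\sigma(w)-\frac h2\sum_{v}\sigma(v),$$ the first sum over unordered pairs of distinct vertices (so that flipping one spin changes the interaction energy by $J_{d(v,w)}$ per pair whose agreement status changes; equivalently $\mathcal H(\sigma)-\mathcal H(\boxminus)=\sum_{v\in\sigma,\,w\notin\sigma}J_{d(v,w)}-h|\sigma|$). Two configurations are neighbours ($\sigma\sim\eta$) if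 they differ at exactly one vertex; a path is a sequence of configurations in which consecutive ones are neighbours. The communication height is $\Phi(\sigma,\eta)=\min_{\text{paths }\sigma\to\eta}\max_{\xi\in\text{path}}\mathcal H(\xi)$. The stability level of $\sigma$ is $V_\sigma=\min_{\eta:\mathcal H(\eta)<\mathcal H(\sigma)}\Phi(\sigma,\eta)-\mathcal H(\sigma)$. $\Omega_{\mathrm{stab}}$ is the set of global minimisers of $\mathcal H$, and $\Omega_{\mathrm{meta}}=\{\sigma\in\Omega\setminus\Omega_{\mathrm{stab}}: V_\sigma=\max_{\eta\in\Omega\setminus\Omega_{\mathrm{stab}}}V_\eta\}$. *)

(* Defs.v *)
From HB Require Import structures.
From mathcomp Require Import all_boot all_order all_algebra.
From mathcomp Require Import reals.
Set Implicit Arguments. Unset Strict Implicit. Unset Printing Implicit Defensive.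
Import Order.TTheory GRing.Theory Num.Theory.
Local Open Scope ring_scope.

(* Vertices of the hierarchical lattice Lambda_N^n: the integer a in
   {1,...,N^n} is represented by the ordinal a-1 : 'I_(N^n).  The k-block
   {jN^k+1,...,(j+1)N^k} then corresponds to the ordinals v with v %/ N^k = j. *)
Definition vertex (N n : nat) := 'I_(N ^ n).

(* Hierarchical distance: smallest k (0 <= k <= n) such that v, w lie in a
   common k-block.  (k = n always works, since v, w < N^n.) *)
Definition hdist (N n : nat) (v w : vertex N n) : nat :=
  find (fun k => (v %/ N ^ k)%N == (w %/ N ^ k)%N) (iota 0 n.+1).

(* Configurations, identified with the set of vertices carrying spin +1. *)
Definition config (N n : nat) := {set vertex N n}.

Definition spin (R : realType) (N n : nat) (s : config N n) (v : vertex N n) : R :=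
  if v \in s then 1 else -1.

Definition boxminus (N n : nat) : config N n := set0.

(* Hamiltonian; the interaction sum is over unordered pairs {v,w}, v <> w,
   enumerated as v < w. *)
Definition ham (R : realType) (N n : nat) (J : nat -> R) (h : R)
    (s : config N n) : R :=
  - (1 / 2) * (\sum_(v : vertex N n) \sum_(w : vertex N n | (v < w)%N)
                 J (hdist v w) * spin R s v * spin R s w)
  - h / 2 * \sum_(v : vertex N n) spin R s v.

Definition neighb (N n : nat) (s t : config N n) : bool :=
  #|(s :\: t) :|: (t :\: s)| == 1%N.

Section Energy.
Variables (R : realType) (N n : nat) (J : nat -> R) (h : R).
Local Notation H := (@ham R N n J h).

Definition path_below (c : R) (s t : config N n) : bool :=
  (H s <= c) && connect (fun x y => neighb x y && (H y <= c)) s t.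

(* Global maximum of the energy (used only as a neutral default for the
   finite minima below; every config is connected to every other at this
   level, so it never changes the value of a nonempty minimum). *)
Definition Hmax : R := \big[Num.max/H (boxminus N n)]_(x : config N n) H x.

(* Communication height Phi(s,t) = min over paths of the max energy along the
   path; since the max along a path is one of the energies H xi, this is the
   minimum of H xi over those xi such that a path with all energies <= H xi
   exists. *)
Definition comm_height (s t : config N n) : R :=
  \big[Num.min/Hmax]_(xi : config N n | path_below (H xi) s t) H xi.

Definition stab_level (s : config N n) : R :=
  \big[Num.min/Hmax]_(t : config N n | H t < H s) comm_height s t - H s.

Definition Omega_stab : {set config N n} :=
  [set s | [forall t, H s <= H t]].

Definition Omega_meta : {set config N n} :=
  [set s | (s \notin Omega_stab) &&
           [forall t, (t \notin Omega_stab) ==> (stab_level t <= stab_level s)]].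
End Energy.

(* Main.v *)
(* Since all couplings are positive, the energy H is submodular, strictly so on
   pairs of sets neither of which contains the other.  Moreover, from every
   vertex v there starts a chain of sets, one vertex being added at a time,
   each minimising H among the sets of its size.  To see this, write the
   interface energy as J_n |A| (N^n - |A|) plus the sum over 1 <= k < n of
   (J_k - J_{k+1}) times the number of pairs of opposite spins lying in a common
   k-block.  If J is nonincreasing, all these numbers are minimised at once by
   sets with at most one partially filled block per level; if J is
   nondecreasing, all are maximised at once by sets whose k-block counts differ
   by at most 1.  Both kinds of sets can be grown greedily.
   Let E(a) be the minimal energy at size a, m0 the first size with
   E(m0) < E(0), and G the maximum of E on [0, m0]; then G - E(0) bounds the
   stability level of the empty set from below.  For any other s <> setT, take
   the chain w from a vertex outside s: by submodularity
   H(s u w_a) - H(s) <= E(a) - H(s n w_a), so the path s u w_a, a <= m0, leads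
   below H(s) and stays strictly under the barrier G - E(0).  The only delicate
   case, s inside w_a with H(s) = E(0), is settled by showing that E stays
   strictly below G after it returns to E(0). *)
Require Import Defs.
From HB Require Import structures.
From mathcomp Require Import all_boot all_order all_algebra.
From mathcomp Require Import reals boolp zify ring lra.
Import Order.TTheory GRing.Theory Num.Theory.
Set Implicit Arguments. Unset Strict Implicit. Unset Printing Implicit Defensive.

(** * Cuts of a set along a partition into classes of equal size *)

Section Partition.
Variables (T I : finType) (p : T -> I) (K : nat).

Definition block_count (A : {set T}) (j : I) := #|[set v in A | p v == j]|.

Definition cut (A : {set T}) :=
  \sum_(v in A) #|[set w | (w \notin A) && (p w == p v)]|.

Definition mixed (A : {set T}) (j : I) :=
  exists v w, [/\ v \in A, w \notin A, p v = j & p w = j].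

(** Only attained labels are constrained; [I] may contain labels of empty classes. *)
Definition class_card := forall v, #|[set w | p w == p v]| = K.

Lemma block_count_le A v : class_card -> block_count A (p v) <= K.
Proof.
by move=> hK; rewrite -(hK v); apply/subset_leq_card/subsetP => x; rewrite !inE => /andP[].
Qed.

Lemma card_block_setC (A : {set T}) v : class_card ->
  #|[set w | (w \notin A) && (p w == p v)]| + block_count A (p v) = K.
Proof.
move=> hK; rewrite -(hK v) -(cardsID A [set w | p w == p v]) addnC.
by congr (_ + _); apply: eq_card => x; rewrite !inE // andbC.
Qed.

Lemma sum_block_count (A : {set T}) : \sum_j block_count A j = #|A|.
Proof.
rewrite -sum1_card (partition_big p xpredT) //=; apply: eq_bigr => j _.
by rewrite sum1dep_card.
Qed.

(* Periodic extension of [x * (K - x)] from [0, K] to all naturals. *)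
Definition periodic_cut x := (x %% K) * (K - x %% K).

(** For residues [a] and [b] the gap is [2ab] if [a + b < K] and [2(K - a)(K - b)] otherwise. *)
Lemma periodic_cut_subadd x y :
  periodic_cut (x + y) <= periodic_cut x + periodic_cut y.
Proof.
rewrite /periodic_cut -modnDm.
case: (posnP K) => [->|K0]; first by rewrite !muln0.
have := ltn_pmod x K0; have := ltn_pmod y K0.
move: (x %% K) (y %% K) => a b hb ha.
case: (ltnP (a + b) K) => hab; first by rewrite modn_small //; nia.
have -> : (a + b) %% K = a + b - K.
  by rewrite -[in LHS](subnK hab) modnDr modn_small //; lia.
nia.
Qed.

Lemma cutE A : class_card -> cut A = \sum_j periodic_cut (block_count A j).
Proof.
move=> hK; rewrite /cut (partition_big p xpredT) //=; apply: eq_bigr => j _.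
rewrite (eq_bigr (fun=> K - block_count A j)); last first.
  by move=> v /andP[vA /eqP <-]; rewrite -(card_block_setC A v hK) addnK.
rewrite sum_nat_const.
have -> : #|[pred i in A | p i == j]| = block_count A j.
  by rewrite /block_count cardsE; apply: eq_card => x; rewrite !inE.
rewrite /periodic_cut; set x := block_count A j.
have [->|x0] := posnP x; first by rewrite mod0n.
have [v] := card_gt0P x0; rewrite inE => /andP[vA /eqP vj].
have := block_count_le A v hK; rewrite vj -/x leq_eqVlt => /orP[/eqP->|xK].
  by rewrite subnn modnn !muln0.
by rewrite modn_small.
Qed.

(** The class counts add up to [#|A|], so subadditivity applies to [cutE]. *)
Lemma cut_ge (A : {set T}) : class_card -> periodic_cut #|A| <= cut A.
Proof.
move=> hK; rewrite cutE // -sum_block_count.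
elim/big_ind2: _ => [|a b c d hab hcd|//]; first by rewrite /periodic_cut mod0n.
by apply: leq_trans (periodic_cut_subadd _ _) (leq_add hab hcd).
Qed.

(** All classes but at most one are full or empty: they add nothing to the cut and a multiple of [K]
    to [#|A|], so the lower bound of [cut_ge] is attained. *)
Lemma cut_le_concentrated (A : {set T}) : class_card ->
  (forall i j, mixed A i -> mixed A j -> i = j) -> cut A <= periodic_cut #|A|.
Proof.
move=> hK hA; rewrite cutE // -sum_block_count.
have nm j : ~ mixed A j -> K %| block_count A j.
  move=> nmj; have [->|x0] := posnP (block_count A j); first exact: dvdn0.
  have [v] := card_gt0P x0; rewrite inE => /andP[vA /eqP vj].
  suff -> : block_count A j = K by [].
  rewrite -(card_block_setC A v hK) vj.
  suff -> : [set w | (w \notin A) && (p w == j)] = set0 by rewrite cards0.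
  apply/setP => w; rewrite !inE; apply/negP => /andP[wA /eqP wj].
  by apply: nmj; exists v, w.
have nm0 j : ~ mixed A j -> periodic_cut (block_count A j) = 0.
  by move=> /nm /eqP; rewrite /periodic_cut => ->.
have [[j0 mj0]|hn] := pselect (exists j, mixed A j); last first.
  by rewrite big1 // => j _; apply: nm0 => mj; apply: hn; exists j.
have ne j : j != j0 -> ~ mixed A j by move=> /eqP jj mj; apply: jj; apply: hA.
rewrite (bigD1 j0) //= big1 ?addn0 => [|j jj]; last by apply/nm0/ne.
rewrite [in leqRHS](bigD1 j0) //= /periodic_cut -modnDmr.
have /eqP -> : K %| \sum_(j | j != j0) block_count A j.
  by apply: dvdn_sum => j jj; apply/nm/ne.
by rewrite addn0.
Qed.

Lemma cut_concentrated_min (A B : {set T}) : class_card ->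
  (forall i j, mixed A i -> mixed A j -> i = j) -> #|B| = #|A| -> cut A <= cut B.
Proof.
move=> hK hA eBA; apply: leq_trans (cut_le_concentrated hK hA) _.
by rewrite -eBA cut_ge.
Qed.

(** Each [v] in [A] is met once from each of the [K] points of its class. Summing over points
    instead of labels keeps the labels of empty classes out. *)
Lemma double_count (A : {set T}) (F : T -> nat) : class_card ->
  (forall u v, p u = p v -> F u = F v) ->
  \sum_u F u * block_count A (p u) = K * \sum_(v in A) F v.
Proof.
move=> hK hF.
under eq_bigr => u _ do rewrite /block_count -sum1dep_card big_distrr /= big_mkcondr /=.
rewrite exchange_big big_distrr /=; apply: eq_bigr => v vA.
rewrite -big_mkcond /= -(hK v) -sum1dep_card big_distrl /=.
under eq_bigl => u do rewrite eq_sym.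
by apply: eq_bigr => u /eqP /hF ->; rewrite muln1 mul1n.
Qed.

(** At fixed size, maximising the cut amounts to minimising the second term, the sum of squared
    class counts. *)
Lemma cut_addn (A : {set T}) : class_card ->
  cut A + \sum_(v in A) block_count A (p v) = K * #|A|.
Proof.
move=> hK; rewrite -big_split /= -sum1_card big_distrr /=.
by apply: eq_bigr => v _; rewrite card_block_setC ?muln1.
Qed.

(* With [q] the least block count of [A], every [c] satisfies
   [c ^ 2 + q (q + 1) >= (2 q + 1) c], with equality iff [c] is [q] or [q + 1]. *)
Lemma cut_spread_max (A B : {set T}) : class_card ->
  (forall u v, block_count A (p u) <= (block_count A (p v)).+1) ->
  #|B| = #|A| -> cut B <= cut A.
Proof.
move=> hK hA eBA.
have [->|[v0 _]] := set_0Vmem B.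
  by rewrite /cut big_set0.
have K0 : 0 < K by rewrite -(hK v0); apply/card_gt0P; exists v0; rewrite inE.
have [u0 _ hu0] := arg_minnP (P := xpredT) (fun u => block_count A (p u)) (isT : xpredT v0).
set q := block_count A (p u0) in hu0.
have sq (C : {set T}) : K * \sum_(v in C) block_count C (p v) =
    \sum_u block_count C (p u) * block_count C (p u).
  by rewrite double_count // => u v ->.
have lin (C : {set T}) : \sum_u block_count C (p u) = K * #|C|.
  rewrite -sum1_card -(double_count C (F := fun=> 1)) //.
  by apply: eq_bigr => u _; rewrite mul1n.
suff : \sum_(v in A) block_count A (p v) <= \sum_(v in B) block_count B (p v).
  by have := cut_addn A hK; have := cut_addn B hK; rewrite eBA; lia.
rewrite -(leq_pmul2l K0) !sq -(leq_add2r (\sum_(u : T) q * q.+1)) -!big_split /=.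
apply: (@leq_trans (\sum_u (q.*2.+1 * block_count B (p u)))); last first.
  apply: leq_sum => u _; set b := block_count B (p u).
  have [/subnKC <-|/subnKC <-] := leqP b q; nia.
rewrite -big_distrr /= lin eBA -lin big_distrr /=.
apply: leq_sum => u _; have := hu0 u isT; have := hA u u0; rewrite -/q.
move: (block_count A (p u)) => a; rewrite leq_eqVlt => /orP[/eqP->|]; first by nia.
by rewrite ltnS => aq qa; have -> : a = q; [lia|nia].
Qed.

End Partition.

(** * Blocks, hierarchical distance, and the two families of extremal sets *)

Section Hierarchy.
Variables (N n : nat).
Implicit Types (u v w : vertex N n) (A B : config N n).

(** Labels live in [vertex N n] itself, so that one label type serves every level. *)
Definition block k v : vertex N n :=
  Ordinal (leq_ltn_trans (leq_div v (N ^ k)) (ltn_ord v)).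

Lemma block_eqE k v w : (block k v == block k w) = (v %/ N ^ k == w %/ N ^ k).
Proof. by []. Qed.

Lemma block0 v : block 0 v = v.
Proof. by apply/val_inj; rewrite /= divn1. Qed.

Lemma block_top v w : block n v = block n w.
Proof. by apply/val_inj; rewrite /= !divn_small. Qed.

Lemma block_coarser j k v w : j <= k -> block j v = block j w -> block k v = block k w.
Proof.
move=> jk /(congr1 val) /= e; apply/val_inj => /=.
by rewrite -(subnKC jk) expnD !divnMA e.
Qed.

Lemma block_class_card k : 0 < N -> k <= n -> class_card (block k) (N ^ k).
Proof.
move=> N0 kn v; have K0 : 0 < N ^ k by rewrite expn_gt0 N0.
have lt (i : 'I_(N ^ k)) : v %/ N ^ k * N ^ k + i < N ^ n.
  have : (v %/ N ^ k).+1 * N ^ k <= N ^ n.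
    rewrite -[in leqRHS](subnK kn) expnD leq_pmul2r // ltn_divLR // -expnD subnK //.
  by have := ltn_ord i; lia.
pose f i : vertex N n := Ordinal (lt i).
rewrite -[RHS]card_ord -(card_imset _ (f := f)); last first.
  by move=> i j /(congr1 val) /= /addnI /val_inj.
apply: eq_card => w; rewrite inE block_eqE; apply/eqP/imsetP => [e|[i _ ->]] /=.
  exists (Ordinal (ltn_pmod w K0)) => //; apply/val_inj => /=.
  by rewrite -e -divn_eq.
by rewrite divnMDl // (divn_small (ltn_ord i)) addn0.
Qed.

Lemma hdist_le v w k : k <= n -> (hdist v w <= k) = (block k v == block k w).
Proof.
move=> kn; rewrite /hdist; set P := (fun k => _ == _).
have hasP : has P (iota 0 n.+1).
  apply/hasP; exists n; first by rewrite mem_iota add0n leqnn.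
  by rewrite /P -block_eqE (block_top v w).
apply/idP/idP => [le|e].
  have := nth_find 0 hasP; rewrite nth_iota ?add0n; last first.
    by rewrite -[X in _ < X](size_iota 0) -has_find.
  by rewrite /P -block_eqE => /eqP e; apply/eqP/(block_coarser le).
rewrite leqNgt; apply/negP => lt.
have := before_find 0 lt; rewrite nth_iota ?add0n //.
by rewrite /P -block_eqE e.
Qed.

Lemma hdist_gt0 v w : v != w -> 0 < hdist v w.
Proof. by rewrite ltnNge hdist_le // !block0. Qed.

Lemma hdist_le_top v w : hdist v w <= n.
Proof. by rewrite hdist_le // (block_top v w). Qed.

Lemma hdistC v w : hdist v w = hdist w v.
Proof. by apply: eq_find => k; rewrite eq_sym. Qed.

Definition concentrated A := forall k, k <= n ->
  forall i j, mixed (block k) A i -> mixed (block k) A j -> i = j.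

Definition spread A := forall k, k <= n -> forall u v,
  block_count (block k) A (block k u) <= (block_count (block k) A (block k v)).+1.

Lemma concentrated1 v : concentrated [set v].
Proof.
by move=> k kn i j [a [? [/set1P -> _ <- _]]] [b [? [/set1P -> _ <- _]]].
Qed.

(* The new vertex is taken in the mixed block of lowest possible level [k0];
   its blocks of smaller level were empty. *)
Lemma concentrated_extend A : concentrated A -> A != set0 -> A != setT ->
  exists2 x, x \notin A & concentrated (x |: A).
Proof.
move=> cA /set0Pn[a0 a0A] AT.
have [w0 _ w0A] : exists2 w, w \in setT & w \notin A.
  by apply/subsetPn; rewrite subTset.
pose Q k := (k <= n) && `[< exists j, mixed (block k) A j >].
have exQ : exists k, Q k.
  exists n; rewrite /Q leqnn; apply/asboolP; exists (block n a0), a0, w0.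
  by split=> //; apply: block_top.
case: (ex_minnP exQ) => k0 /andP[k0n /asboolP[j0 [a [x [aA xA aj xj]]]]] minQ.
exists x => // k kn.
suff H i : mixed (block k) (x |: A) i -> i = block k x by move=> i j /H -> /H ->.
move=> [u [u' [/setU1P[->|uA] ]]] ; first by [].
rewrite !inE negb_or => /andP[_ u'A] ui u'i.
have mi : mixed (block k) A i by exists u, u'.
have k0k : k0 <= k by apply: minQ; rewrite /Q kn; apply/asboolP; exists i.
(* The mixed block of level [k0] lies in the block of [x] at level [k], which is therefore mixed
   too. *)
apply: (cA k) => //; exists a, x; split=> //.
by apply: (block_coarser k0k); rewrite aj.
Qed.

Lemma spread1 v : spread [set v].
Proof.
move=> k kn a b; apply: leq_trans (ltn0Sn _); rewrite -(cards1 v).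
by apply/subset_leq_card/subsetP => x; rewrite !inE => /andP[].
Qed.

Lemma block_count_coarser A k v : 0 < N -> k < n ->
  \sum_(u | block k.+1 u == block k.+1 v) block_count (block k) A (block k u) =
  N ^ k * block_count (block k.+1) A (block k.+1 v).
Proof.
move=> N0 kn.
pose F u := (block k.+1 u == block k.+1 v : nat).
transitivity (\sum_u F u * block_count (block k) A (block k u)).
  by rewrite big_mkcond; apply: eq_bigr => u _; rewrite /F; case: eqP; rewrite ?mul1n.
rewrite (double_count (K := N ^ k)) //.
- congr (_ * _); rewrite /block_count -sum1dep_card big_mkcondr /=.
  by apply: eq_bigr => u _; rewrite /F; case: eqP.
- by apply: block_class_card => //; apply: ltnW.
- by move=> u u' e; rewrite /F (block_coarser (leqnSn k) e).
Qed.

(** Descend from level [n], choosing at each level a least block inside the previous one. If a block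
    elsewhere had a smaller count [c], its siblings would hold at most [c + 1] each and the
    candidates at least [c + 1], so its parent would beat the least parent. *)
Lemma spread_least_block A v k : 0 < N -> spread A -> k <= n ->
  exists w, forall j, k <= j <= n -> forall u,
    block_count (block j) A (block j w) <= block_count (block j) A (block j u).
Proof.
move=> N0 sA kn.
suff H i : i <= n -> exists w, forall j, n - i <= j <= n -> forall u,
    block_count (block j) A (block j w) <= block_count (block j) A (block j u).
  by have [w hw] := H (n - k) (leq_subr _ _); exists w => j; rewrite -{1}(subKn kn); apply: hw.
elim: i => [_|i IH lin].
  exists v => j; rewrite subn0 -eqn_leq => /eqP <- u.
  by rewrite (block_top v u).
have [w hw] := IH (ltnW lin).
set l := n - i.+1; have lE : n - i = l.+1 by lia.
have ln : l < n by lia.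
rewrite lE in hw.
have [x /eqP xw hx] := arg_minnP (P := fun u => block l.+1 u == block l.+1 w)
  (fun u => block_count (block l) A (block l u)) (eqxx _).
exists x => j /andP[lj jn] u.
case: (ltngtP l j) lj => // [lj|<-] _.
  by rewrite (block_coarser lj xw); apply: hw; rewrite lj.
rewrite leqNgt; apply/negP => lt.
have := hw l.+1; rewrite leqnn ln => /(_ isT u); apply/negP; rewrite -ltnNge.
have L0 : 0 < N ^ l by rewrite expn_gt0 N0.
rewrite -(ltn_pmul2l L0) -!block_count_coarser //.
set c := block_count (block l) A (block l u) in lt *.
apply: (@leq_trans (\sum_(y | block l.+1 y == block l.+1 w) c.+1)); last first.
  by apply: leq_sum => y yw; apply: leq_trans lt (hx y yw).
have K z : #|[pred y | block l.+1 y == block l.+1 z]| = N ^ l.+1.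
  by rewrite -(block_class_card N0 ln z) cardsE.
rewrite sum_nat_const K -(K u) -sum_nat_const.
under [ltnRHS]eq_bigl => y do rewrite inE.
rewrite (bigD1 u) //= [ltnRHS](bigD1 u) //= -addSn leq_add2l.
by apply: leq_sum => y _; apply: sA; apply: ltnW.
Qed.

(** The new vertex lies in a least block at every level, where one more element keeps the counts
    within 1 of each other; at level 0, least means unoccupied. *)
Lemma spread_extend A : 0 < N -> spread A -> A != setT ->
  exists2 x, x \notin A & spread (x |: A).
Proof.
move=> N0 sA AT.
have [w0 _ w0A] : exists2 w, w \in setT & w \notin A.
  by apply/subsetPn; rewrite subTset.
have [x hx] := spread_least_block w0 N0 sA (leq0n n).
have c0 v : block_count (block 0) A (block 0 v) = (v \in A).
  rewrite /block_count -sum1dep_card big_mkcondr /= (big_mkcond (mem A)) /=.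
  rewrite (bigD1 v) //= eqxx big1 ?addn0; first by case: (v \in A).
  by move=> y yv; rewrite !block0 (negbTE yv); case: ifP.
have xA : x \notin A.
  by have := hx 0; rewrite leq0n => /(_ isT w0); rewrite !c0 (negbTE w0A); case: (x \in A).
exists x => // k kn.
have cE v : block_count (block k) (x |: A) (block k v) =
    (block k x == block k v) + block_count (block k) A (block k v).
  by rewrite /block_count -!sum1dep_card !big_mkcondr /= big_setU1.
move=> u v; rewrite !cE.
have := sA k kn u v; have := hx k; rewrite kn => /(_ isT v).
case: (eqVneq (block k x) (block k u)) => [<-|_];
  case: (eqVneq (block k x) (block k v)) => [<-|_] /=; lia.
Qed.

End Hierarchy.

Local Open Scope ring_scope.

(** * Greedy construction of chains of minimisers *)

Section OptimalChain.
Variables (R : realType) (T : finType) (f : {set T} -> R).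

(** The start [v] is prescribed so that a chain can begin outside a given configuration. *)
Definition optimal_chain (v : T) (w : nat -> {set T}) :=
  [/\ w 0%N = set0, w 1%N = [set v],
    forall a, (a < #|T|)%N -> exists2 x, x \notin w a & w a.+1 = x |: w a
    & forall a (B : {set T}), #|B| = a -> f (w a) <= f B].

Lemma card_chain v w a : optimal_chain v w -> (a <= #|T|)%N -> #|w a| = a.
Proof.
move=> [w0 _ wS _]; elim: a => [|a IH] aT; first by rewrite w0 cards0.
by have [x xw ->] := wS a aT; rewrite cardsU1 xw IH // ltnW.
Qed.

Lemma greedy_optimal_chain (good : {set T} -> Prop) (v : T) :
  good [set v] ->
  (forall A, good A -> A != set0 -> A != setT ->
     exists2 x, x \notin A & good (x |: A)) ->
  (forall A (B : {set T}), good A -> #|B| = #|A| -> f A <= f B) ->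
  exists w, optimal_chain v w.
Proof.
move=> g1 gS gmin.
pose ext (A : {set T}) := if [pick x | (x \notin A) && `[< good (x |: A) >]] is Some x
  then x |: A else A.
pose w a := if a is b.+1 then iter b ext [set v] else set0.
have extP A : good A -> A != set0 -> A != setT ->
    exists2 x, x \notin A & ext A = x |: A /\ good (x |: A).
  move=> gA A0 AT; rewrite /ext; case: pickP => [x /andP[xA /asboolP gx]|no].
    by exists x.
  have [x xA gx] := gS A gA A0 AT.
  by have := no x; rewrite xA; move/asboolP: gx => ->.
have inv a : (a < #|T|)%N -> good (w a.+1) /\ #|w a.+1| = a.+1.
  elim: a => [|a IH] aT; first by rewrite /= cards1.
  have [ga ca] := IH (ltnW aT).
  have [||x xw [e gx]] := extP _ ga.
  - by rewrite -card_gt0 ca.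
  - by apply: contraTneq aT => e; rewrite -leqNgt -ca e cardsT.
  by rewrite [w a.+2]e cardsU1 xw ca.
exists w; split=> //.
- case=> [|a] aT; first by exists v; rewrite ?inE // setU0.
  have [ga ca] := inv a (ltnW aT).
  have [||x xw [e _]] := extP _ ga; last by exists x.
  - by rewrite -card_gt0 ca.
  - by apply: contraTneq aT => e; rewrite -leqNgt -ca e cardsT.
- case=> [|a] B cB; first by move/eqP: cB; rewrite cards_eq0 => /eqP ->.
  have aT : (a < #|T|)%N by rewrite -cB max_card.
  by have [ga ca] := inv a aT; apply: gmin => //; rewrite ca.
Qed.

End OptimalChain.

(** * Interface energy, submodularity and existence of optimal chains *)

Section Energy.
Variables (R : realType) (N n : nat) (J : nat -> R) (h : R).
Local Notation H := (@ham R N n J h).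
Implicit Types (v w : vertex N n) (A B : config N n).

Definition interface A : R :=
  \sum_(v : vertex N n) \sum_w J (hdist v w) * ((v \in A) && (w \notin A))%:R.

Lemma hamE A : H A = H set0 + interface A - h * #|A|%:R.
Proof.
have spinE B v : @spin R N n B v = 2 * (v \in B)%:R - 1.
  by rewrite /spin; case: (v \in B); rewrite /= ?mulr1 ?mulr0; lra.
(* Both orders of a pair combine into an exclusive or, and a product of two spins is 1 minus twice
   that indicator. *)
have sumE : interface A = \sum_(v : vertex N n) \sum_(w : vertex N n | (v < w)%N)
    J (hdist v w) * ((v \in A) (+) (w \in A))%:R.
  rewrite /interface.
  transitivity (\sum_(v : vertex N n) (\sum_(w : vertex N n | (v < w)%N) J (hdist v w) * ((v \in A) && (w \notin A))%:R
    + \sum_(w : vertex N n | (w < v)%N) J (hdist v w) * ((v \in A) && (w \notin A))%:R)).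
    apply: eq_bigr => v _; rewrite (bigID (fun w : vertex N n => (v < w)%N)) /=; congr (_ + _).
    rewrite (bigID (fun w : vertex N n => w == v)) /= big1 ?add0r; last first.
      by move=> w /andP[_ /eqP ->]; rewrite andbN mulr0.
    by apply: eq_bigl => w; rewrite -leqNgt ltn_neqAle andbC.
  rewrite big_split /= [X in _ + X](exchange_big_dep xpredT) //= -big_split /=.
  apply: eq_bigr => v _; rewrite -big_split /=; apply: eq_bigr => w _.
  rewrite (hdistC w v) -mulrDr; congr (_ * _).
  by case: (v \in A); case: (w \in A); rewrite /= ?addr0 ?add0r.
rewrite sumE /ham -sum1_card natr_sum.
have -> : \sum_v @spin R N n A v = \sum_v @spin R N n set0 v + 2 * \sum_(i in A) 1%:R.
  rewrite [X in 2 * X]big_mkcond big_distrr -big_split /=; apply: eq_bigr => v _.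
  by rewrite !spinE inE /=; case: (v \in A) => /=; ring.
have -> : \sum_(v : vertex N n) \sum_(w : vertex N n | (v < w)%N) J (hdist v w) * spin R A v * spin R A w =
  \sum_(v : vertex N n) \sum_(w : vertex N n | (v < w)%N) J (hdist v w) * spin R set0 v * spin R set0 w
   + (- 2) * \sum_(v : vertex N n) \sum_(w : vertex N n | (v < w)%N) J (hdist v w) * ((v \in A) (+) (w \in A))%:R.
  rewrite big_distrr -big_split /=; apply: eq_bigr => v _.
  rewrite big_distrr -big_split /=; apply: eq_bigr => w _.
  by rewrite !spinE !inE /=; case: (v \in A); case: (w \in A) => /=; ring.
set a := \sum_(v : vertex N n) \sum_(w | _) _; set b := \sum_(v : vertex N n) \sum_(w | _) _.
set c := \sum_v spin _ _ _; set d := \sum_(i in A) _.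
lra.
Qed.

(** Summation by parts: [J d] is [J n] plus the differences [J k - J k.+1] over [d <= k < n], and
    [d <= k] means lying in a common [k]-block. *)
Lemma interface_decomp A : (0 < N)%N -> (0 < n)%N ->
  interface A = J n * (#|A| * (N ^ n - #|A|))%:R +
    \sum_(1 <= k < n) (J k - J k.+1) * (cut (@block N n k) A)%:R.
Proof.
move=> N0 n0.
have Jd d : (0 < d <= n)%N ->
    J d = J n + \sum_(1 <= k < n) (J k - J k.+1) * (d <= k)%:R.
  move=> /andP[d0 dn]; rewrite (big_cat_nat (n := d)) //= big1_seq ?add0r; last first.
    by move=> k /=; rewrite mem_index_iota => /andP[_ kd]; rewrite leqNgt kd mulr0.
  rewrite (eq_big_seq (fun k => - (J k.+1 - J k))); last first.
    by move=> k; rewrite mem_index_iota => /andP[dk _]; rewrite dk mulr1 opprB.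
  by rewrite sumrN telescope_sumr //; ring.
have cutE k : (cut (@block N n k) A)%:R = \sum_v \sum_w
    ((v \in A) && (w \notin A) && (block k w == block k v))%:R :> R.
  rewrite /cut natr_sum big_mkcond; apply: eq_bigr => v _.
  case: (v \in A) => /=; last by rewrite big1.
  rewrite -sum1dep_card natr_sum big_mkcond; apply: eq_bigr => w _.
  by case: ifP.
have cardE : (#|A| * (N ^ n - #|A|))%:R = \sum_v \sum_w ((v \in A) && (w \notin A))%:R :> R.
  transitivity (\sum_v (v \in A)%:R * \sum_w (w \notin A)%:R : R).
    rewrite -big_distrl /= natrM; congr (_ * _).
      by rewrite -sum1_card natr_sum big_mkcond; apply: eq_bigr => v _; case: ifP.
    have -> : (N ^ n - #|A| = #|~: A|)%N by apply/eqP; rewrite -(eqn_add2l #|A|) cardsC card_ord subnKC // -[leqRHS]card_ord max_card.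
    rewrite -sum1_card natr_sum big_mkcond; apply: eq_bigr => v _.
    by rewrite inE; case: ifP.
  apply: eq_bigr => v _; rewrite big_distrr /=; apply: eq_bigr => w _.
  by rewrite -natrM mulnb.
under [X in _ + X]eq_bigr do rewrite cutE big_distrr /=.
rewrite cardE big_distrr exchange_big -big_split /=; apply: eq_bigr => v _.
under [X in _ + X]eq_bigr do rewrite big_distrr /=.
rewrite big_distrr exchange_big -big_split /=; apply: eq_bigr => w _.
have [/andP[vA wA]|_] := boolP ((v \in A) && (w \notin A)); last first.
  by rewrite !mulr0 big1 ?addr0 // => k _; rewrite /= mulr0.
have vw : v != w by apply: contraNneq wA => <-.
rewrite !mulr1 Jd ?hdist_gt0 ?hdist_le_top //; congr (_ + _).
apply: eq_big_seq => k; rewrite mem_index_iota => /andP[_ kn].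
by rewrite hdist_le 1?ltnW // eq_sym.
Qed.

(** The value is the left side of the assumption on [h], which thus says that a single plus spin
    raises the energy of the all-minus configuration. *)
Lemma interface1 v : (0 < N)%N -> (0 < n)%N ->
  interface [set v] = (1 - 1 / N%:R) * \sum_(1 <= i < n.+1) J i * (N ^ i)%:R.
Proof.
move=> N0 n0; rewrite interface_decomp // cards1 mul1n.
have c1 k : (k <= n)%N -> cut (@block N n k) [set v] = (N ^ k - 1)%N.
  move=> kn; have hK := block_class_card N0 kn.
  have := cut_addn [set v] hK; rewrite cards1 muln1 big_set1.
  suff -> : block_count (block k) [set v] (block k v) = 1%N by lia.
  rewrite /block_count -(cards1 v); apply: eq_card => x.
  by rewrite !inE; case: eqP => // ->; rewrite eqxx.
rewrite (eq_big_seq (fun k => (J k - J k.+1) * (N ^ k - 1)%:R)); last first.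
  by move=> k; rewrite mem_index_iota => /andP[_ /ltnW kn]; rewrite c1.
have Nnz : N%:R != 0 :> R by rewrite pnatr_eq0 -lt0n.
have powE k : (N ^ k - 1)%:R = (N ^ k)%:R - 1 :> R.
  by rewrite natrB // expn_gt0 N0.
case: n n0 => // m _ {v c1}; elim: m => [|m IH].
  by rewrite big_nil big_nat1 powE expn1; field.
rewrite big_nat_recr //= [in RHS]big_nat_recr //= mulrDr -IH !powE.
by rewrite [in (N ^ m.+2)%N]expnS natrM; field.
Qed.

(** Pairs split between the two differences are cut by [A] and by [B] but by neither union nor
    intersection; [ham_submodE] shows that they make up the whole submodularity defect. *)
Definition exchange A B v w : R := J (hdist v w) *
  ((v \in A :\: B) && (w \in B :\: A) || (v \in B :\: A) && (w \in A :\: B))%:R.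

Lemma exchange_ge0 A B v w : (forall i, (1 <= i <= n)%N -> 0 < J i) ->
  0 <= exchange A B v w.
Proof.
move=> J0; rewrite /exchange; have [->|vw] := eqVneq v w.
  by rewrite !inE; case: (w \in A); case: (w \in B); rewrite /= mulr0.
by rewrite mulr_ge0 ?ler0n // ltW // J0 // hdist_gt0 // hdist_le_top.
Qed.

Lemma ham_submodE A B :
  H A + H B = H (A :|: B) + H (A :&: B) + \sum_v \sum_w exchange A B v w.
Proof.
rewrite (hamE (_ :|: _)) (hamE (_ :&: _)) (hamE A) (hamE B).
have cE : #|A :|: B|%:R + #|A :&: B|%:R = #|A|%:R + #|B|%:R :> R.
  by rewrite -!natrD cardsUI.
suff : interface A + interface B = interface (A :|: B) + interface (A :&: B) +
    \sum_v \sum_w exchange A B v w by nra.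
rewrite /interface -!big_split /=; apply: eq_bigr => v _.
rewrite -!big_split /=; apply: eq_bigr => w _; rewrite /exchange !inE.
by case: (v \in A); case: (v \in B); case: (w \in A); case: (w \in B) => /=; ring.
Qed.

Lemma ham_submod A B : (forall i, (1 <= i <= n)%N -> 0 < J i) ->
  H (A :|: B) + H (A :&: B) <= H A + H B.
Proof.
move=> J0; rewrite (ham_submodE A B) lerDl.
by apply: sumr_ge0 => v _; apply: sumr_ge0 => w _; apply: exchange_ge0.
Qed.

Lemma ham_submod_strict A B : (forall i, (1 <= i <= n)%N -> 0 < J i) ->
  ~~ (A \subset B) -> ~~ (B \subset A) ->
  H (A :|: B) + H (A :&: B) < H A + H B.
Proof.
move=> J0 /subsetPn[a aA aB] /subsetPn[b bB bA]; rewrite (ham_submodE A B) ltrDl.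
have ge0 v w := exchange_ge0 A B v w J0.
have ab : a != b by apply: contraNneq aB => ->.
rewrite (bigD1 a) //= (bigD1 b) //= -addrA ltr_pwDl ?addr_ge0 ?sumr_ge0 //.
  by rewrite /exchange !inE aA aB bA bB mulr1 J0 // hdist_gt0 // hdist_le_top.
by move=> v _; apply: sumr_ge0.
Qed.

Lemma ham_chain v : (0 < N)%N -> (0 < n)%N ->
  ((forall i, (1 <= i)%N -> (i < n)%N -> J i.+1 <= J i) \/
   (forall i, (1 <= i)%N -> (i < n)%N -> J i <= J i.+1)) ->
  exists ch, optimal_chain H v ch.
Proof.
move=> N0 n0 [] mono.
- apply: (greedy_optimal_chain (good := @concentrated N n)).
  + exact: concentrated1.
  + exact: concentrated_extend.
  + move=> A B cA eBA; rewrite (hamE A) (hamE B) !interface_decomp // eBA.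
    rewrite lerD2r !lerD2l; apply: ler_sum_nat => k /andP[k0 kn].
    have hK := block_class_card N0 (ltnW kn).
    rewrite ler_wpM2l ?subr_ge0 ?mono // ler_nat (cut_concentrated_min hK) //.
    by apply: cA; apply: ltnW.
- apply: (greedy_optimal_chain (good := @spread N n)).
  + exact: spread1.
  + by move=> A gA _; apply: spread_extend.
  + move=> A B cA eBA; rewrite (hamE A) (hamE B) !interface_decomp // eBA.
    rewrite lerD2r !lerD2l; apply: ler_sum_nat => k /andP[k0 kn].
    have hK := block_class_card N0 (ltnW kn).
    rewrite ler_wnM2l ?subr_le0 ?mono // ler_nat (cut_spread_max hK) //.
    by move=> u u'; apply: cA; apply: ltnW.
Qed.

Lemma ham_setT_lt A : 0 < h -> (forall i, (1 <= i <= n)%N -> 0 < J i) ->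
  A != setT -> H setT < H A.
Proof.
move=> h0 J0 AT; rewrite (hamE setT) (hamE A).
have -> : interface setT = 0.
  by rewrite /interface !big1 // => v _; rewrite big1 // => w _; rewrite !inE mulr0.
have IA : 0 <= interface A.
  apply: sumr_ge0 => v _; apply: sumr_ge0 => w _.
  have [->|vw] := eqVneq v w; first by rewrite andbN mulr0.
  by rewrite mulr_ge0 ?ler0n // ltW // J0 // hdist_gt0 // hdist_le_top.
have cA : #|A|%:R < #|[set: vertex N n]|%:R :> R.
  by rewrite ltr_nat proper_card // properT.
nra.
Qed.

End Energy.

(** * Escape paths and the barrier, for an abstract energy *)

Lemma neighb_setU1 N n (x : vertex N n) (A : config N n) : x \notin A -> neighb A (x |: A).
Proof.
move=> xA; rewrite /neighb; apply/eqP; rewrite -(cards1 x); apply: eq_card => y.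
by rewrite !inE; case: eqVneq => [->|_] /=; [rewrite (negbTE xA)|case: (y \in A)].
Qed.

Section Landscape.
Variables (R : realType) (N n : nat) (f : config N n -> R).
Hypothesis f_submod : forall A B : config N n, f (A :|: B) + f (A :&: B) <= f A + f B.
Hypothesis f_submod_strict : forall A B : config N n, ~~ (A \subset B) -> ~~ (B \subset A) ->
  f (A :|: B) + f (A :&: B) < f A + f B.
Hypothesis f_chain : forall v, exists w, optimal_chain f v w.
Variables (v0 : vertex N n) (w0 : nat -> config N n).
Hypothesis w0_chain : optimal_chain f v0 w0.
Local Notation E a := (f (w0 a)).
Local Notation T := (vertex N n).

Variables (m0 : nat) (G : R).
Hypothesis m0_max : (m0 <= #|{: T}|)%N.
Hypothesis m0_neg : E m0 < E 0.
Hypothesis m0_min : forall b, (b < m0)%N -> E 0 <= E b.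
Hypothesis G_max : forall a, (a <= m0)%N -> E a <= G.
Hypothesis G_gt : E 0 < G.

Lemma profile_le (A : config N n) : E #|A| <= f A.
Proof. by case: w0_chain => _ _ _; apply. Qed.

Lemma small_ge (A : config N n) : (#|A| < m0)%N -> E 0 <= f A.
Proof. by move=> /m0_min h; apply: le_trans h (profile_le A). Qed.

(** Both sides are the minimum of [f] at size [a], so chains from all starts share one profile. *)
Lemma profile_eq v w a : optimal_chain f v w -> (a <= #|{: T}|)%N -> f (w a) = E a.
Proof.
move=> cw aT; apply/le_anti/andP; split.
  by case: cw => _ _ _; apply; apply: card_chain w0_chain aT.
by have := profile_le (w a); rewrite (card_chain cw aT).
Qed.

Lemma chain_mem v w a : optimal_chain f v w -> (0 < a <= #|{: T}|)%N -> v \in w a.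
Proof.
move=> [_ w1 wS _]; case: a => // a; elim: a => [|a IH] aT; first by rewrite w1 inE.
have [x _ ->] := wS a.+1 aT; rewrite inE IH ?orbT //.
by apply: ltnW.
Qed.

(* A set of size [a] is obtained as the union of optimal sets of sizes [b] and
   [c < a]; putting in the first a vertex missed by [w0 a.-1] makes [c < a] possible. *)
Lemma profile_lt_after_dip a b : (0 < b <= a)%N -> (a <= m0)%N -> (b < m0)%N ->
  E b <= E 0 -> E a < G.
Proof.
move=> /andP[b0]; rewrite leq_eqVlt => /orP[/eqP <- _ _ /le_lt_trans|ab am0 bm0 Eb]; first exact.
have aT : (a <= #|{: T}|)%N by apply: leq_trans m0_max.
have a1T : (a.-1 <= #|{: T}|)%N by apply: leq_trans aT; apply: leq_pred.
have c1 := card_chain w0_chain a1T.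
have [v _ vw] : exists2 v, v \in setT & v \notin w0 a.-1.
  apply/subsetPn; apply: contraTN aT; rewrite subTset => /eqP e.
  by rewrite -ltnNge -cardsT -e c1; lia.
have [w cw] := f_chain v.
have bT : (b <= #|{: T}|)%N by apply: leq_trans aT; apply: ltnW.
set A := w b; have cA : #|A| = b by apply: card_chain cw bT.
have vA : v \in A by apply: chain_mem cw _; rewrite b0.
have ex : exists c, (a <= #|A :|: w0 c|)%N.
  exists a.-1; apply: (@leq_trans #|v |: w0 a.-1|).
    by rewrite cardsU1 vw c1; lia.
  by apply/subset_leq_card; rewrite setSU // sub1set.
case: (ex_minnP ex) => c ac cmin.
have ca : (c <= a.-1)%N.
  apply: cmin; apply: (@leq_trans #|v |: w0 a.-1|).
    by rewrite cardsU1 vw c1; lia.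
  by apply/subset_leq_card; rewrite setSU // sub1set.
have cT : (c <= #|{: T}|)%N by apply: leq_trans ca _.
have cc := card_chain w0_chain cT.
(* Raising [c] by one adds at most one vertex, so the least [c] meets size [a] exactly. *)
have eqa : #|A :|: w0 c| = a.
  apply/eqP; rewrite eqn_leq ac andbT.
  case: c cmin {ac cc} ca cT => [|c] cmin ca cT.
    by case: w0_chain => -> _ _ _; rewrite setU0 cA ltnW.
  have : ~~ (a <= #|A :|: w0 c|)%N by apply/negP => /cmin; rewrite ltnn.
  case: w0_chain => _ _ /(_ c cT)[x _ ->] _.
  rewrite setUCA cardsU1; case: (x \notin _); lia.
have := @f_submod_strict A (w0 c) _ _; rewrite (profile_eq cw bT).
have -> : ~~ (A \subset w0 c).
  by apply/negP => /setUidPr e; move: eqa; rewrite e cc; lia.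
have -> : ~~ (w0 c \subset A).
  by apply/negP => /setUidPl e; move: eqa; rewrite e cA; lia.
move=> /(_ isT isT) lt.
(* Altogether [E a + E 0 < E b + E c <= E 0 + G]. *)
have := profile_le (A :|: w0 c); rewrite eqa.
have : E 0 <= f (A :&: w0 c).
  apply: small_ge; apply: (@leq_ltn_trans #|w0 c|); last by rewrite cc; lia.
  by apply/subset_leq_card/subsetIr.
have : E c <= G by apply: G_max; lia.
lra.
Qed.

Lemma escape (s : config N n) : s != set0 -> s != setT ->
  exists2 t, f t < f s &
    connect (fun x y => neighb x y && (f y < f s + (G - E 0))) s t.
Proof.
move=> s0 sT.
have [v _ vs] : exists2 v, v \in setT & v \notin s by apply/subsetPn; rewrite subTset.
have [w cw] := f_chain v.
have m0_gt0 : (0 < m0)%N by case: (m0) m0_neg => //; rewrite ltxx.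
(* As [v] is not in [s], the intersection is smaller than [m0] even at [a = m0], so its energy is at
   least [E 0]. *)
have meet a : (0 < a <= m0)%N -> (#|s :&: w a| < a)%N.
  move=> /andP[a0 am0]; have aT := leq_trans am0 m0_max.
  rewrite -[ltnRHS](card_chain cw aT); apply: proper_card; apply/properP.
  split; first exact: subsetIr.
  exists v; last by rewrite inE (negbTE vs).
  by apply: chain_mem cw _; rewrite a0.
have below a : (a <= m0)%N -> f (s :|: w a) < f s + (G - E 0).
  move=> am0; have aT := leq_trans am0 m0_max.
  have [->|a0] := posnP a.
    by case: cw => -> _ _ _; rewrite setU0; have := G_gt; lra.
  have va : v \in w a by apply: chain_mem cw _; rewrite a0.
  have lam : (#|s :&: w a| < a)%N by apply: meet; rewrite a0.
  have [sw|sw] := boolP (s \subset w a); last first.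
    have nws : ~~ (w a \subset s) by apply/subsetPn; exists v.
    have := f_submod_strict sw nws; rewrite (profile_eq cw aT).
    have := small_ge (leq_trans lam am0); have := G_max am0; lra.
  move: lam; rewrite (setIidPl sw) => lam; rewrite (setUidPr sw) (profile_eq cw aT).
  have := profile_le s; have := m0_min (leq_trans lam am0); have := G_max am0.
  (* Here [s] lies inside [w a], so submodularity gives nothing strict. If the profile at [#|s|]
     exceeds [E 0], so does [f s]; otherwise the profile has dipped before [a]. *)
  have [Eb|] := leP (E #|s|) (E 0); last by lra.
  suff : E a < G by lra.
  apply: (@profile_lt_after_dip a #|s|) => //; last exact: leq_trans am0.
  by rewrite card_gt0 s0 ltnW.
exists (s :|: w m0).
  have := f_submod s (w m0); rewrite (profile_eq cw m0_max).
  have : E 0 <= f (s :&: w m0) by apply: small_ge; apply: meet; rewrite m0_gt0 leqnn.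
  have := m0_neg; lra.
suff H a : (a <= m0)%N -> connect (fun x y => neighb x y && (f y < f s + (G - E 0)))
    s (s :|: w a) by exact: H.
elim: a => [|a IH] am0; first by case: cw => -> _ _ _; rewrite setU0 connect0.
apply: connect_trans (IH (ltnW am0)) _.
have := below _ am0; case: (cw) => _ _ /(_ a (leq_trans am0 m0_max))[x xw ->] _.
have [xs|xs] := boolP (x \in s).
  by rewrite setUCA (setUidPr _) ?connect0 // sub1set inE xs.
by rewrite setUCA => lt; apply: connect1; rewrite lt andbT neighb_setU1 // inE negb_or xs.
Qed.

(** Sizes change by at most 1 along a path, and a target below [f set0] cannot have size under [a],
    so the path meets size [a], where the energy is at least [E a]. *)
Lemma barrier a (c : R) (t : config N n) : (a <= m0)%N -> E 0 < E a -> f t < f set0 ->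
  connect (fun x y => neighb x y && (f y <= c)) set0 t -> E a <= c.
Proof.
move=> am0 a0 ft; rewrite leNgt => /connectP[p pp tE]; apply/negP => ca.
have aT := leq_trans am0 m0_max.
have a_gt0 : (0 < a)%N by case: (a) a0 => //; rewrite ltxx.
have step (x y : config N n) : (#|x| < a)%N -> neighb x y -> f y <= c -> (#|y| < a)%N.
  move=> xa nxy fy.
  have : (#|y| <= #|x|.+1)%N.
    rewrite -(cardsID x y) -addn1 -(eqP nxy) leq_add //.
      by apply/subset_leq_card/subsetIr.
    by apply/subset_leq_card/subsetUr.
  rewrite leq_eqVlt => /orP[/eqP e|]; last by rewrite ltnS => /leq_ltn_trans; apply.
  rewrite e ltn_neqAle xa andbT; apply/negP => /eqP ea.
  by have := profile_le y; rewrite e ea; lra.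
have : (#|t| < a)%N.
  rewrite tE; have : (#|@set0 (vertex N n)| < a)%N by rewrite cards0.
  move: set0 pp {tE}; elim: p => //= y p IH x /andP[/andP[xy fy] yp] xa.
  by apply: IH yp _; apply: step xa xy fy.
move=> ta; have := small_ge (leq_trans ta am0).
by case: w0_chain => -> _ _ _; rewrite leNgt ft.
Qed.

End Landscape.

(** * Bounds on stability levels from paths *)

Section StabilityLevel.
Variables (R : realType) (N n : nat) (J : nat -> R) (h : R).
Local Notation H := (@ham R N n J h).
Implicit Types s t x : config N n.

Lemma stab_level_lt s t (g : R) : H t < H s -> H s < g ->
  connect (fun x y => neighb x y && (H y < g)) s t -> stab_level J h s < g - H s.
Proof.
move=> ts sg st; rewrite /stab_level ltrD2r.
apply: le_lt_trans (bigmin_le_cond _ (comm_height J h s) ts) _; rewrite /comm_height.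
(* A communication height is the energy of some configuration, so [g] is replaced by the largest
   energy [H x] below it; this leaves the sublevel set unchanged. *)
have [x xg xmax] := arg_maxP (P := fun x => H x < g) (fun x => H x) sg.
have le_lt y : (H y <= H x) = (H y < g).
  by apply/idP/idP => [/le_lt_trans|/xmax]; [apply|].
suff sx : path_below J h (H x) s t.
  apply: le_lt_trans xg.
  exact: (bigmin_le_cond (P := fun y => path_below J h (H y) s t) _ H sx).
rewrite /path_below le_lt sg /=.
by rewrite (eq_connect (e' := fun x y => neighb x y && (H y < g))) // => ? ?; rewrite le_lt.
Qed.

(** The bound [g <= Hmax] covers the default value of both minima. *)
Lemma stab_level_ge s (g : R) : g <= Hmax N n J h ->
  (forall t c, H t < H s -> connect (fun x y => neighb x y && (H y <= c)) s t -> g <= c) ->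
  g - H s <= stab_level J h s.
Proof.
move=> gH hg; rewrite /stab_level lerD2r; apply: le_bigmin => // t ts.
by apply: le_bigmin => // x /andP[_]; apply: hg.
Qed.

Lemma ham_le_Hmax s : H s <= Hmax N n J h.
Proof. exact: (le_bigmax_cond _ H). Qed.

End StabilityLevel.

Theorem theorem1p8 (R : realType) (N n : nat) (J : nat -> R) (h : R) :
  (2 <= N)%N -> (1 <= n)%N -> 0 < h ->
  (forall i, (1 <= i <= n)%N -> 0 < J i) ->
  ((forall i, (1 <= i)%N -> (i < n)%N -> J i.+1 <= J i) \/
   (forall i, (1 <= i)%N -> (i < n)%N -> J i <= J i.+1)) ->
  (1 - 1 / N%:R) * (\sum_(1 <= i < n.+1) J i * (N ^ i)%:R) > h ->
  @Omega_meta R N n J h = [set boxminus N n].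
Proof.
move=> N2 n1 h0 J0 mono hJ.
have N0 : (0 < N)%N by apply: ltnW.
pose H := @ham R N n J h.
have chains v : exists w, optimal_chain H v w by apply: ham_chain.
have Hfull (A : config N n) : A != setT -> H setT < H A by apply: ham_setT_lt.
have T0 : (0 < N ^ n)%N by rewrite expn_gt0 N0.
pose v0 : vertex N n := Ordinal T0.
have [w cw] := chains v0.
have w0E : w 0%N = set0 by case: cw.
(* The assumption on [h] makes the first step uphill, so the barrier is positive. *)
have H01 : H set0 < H (w 1%N).
  case: (cw) => _ -> _ _; rewrite /H (hamE _ _ [set v0]) cards1 mulr1 interface1 //; lra.
have wT : w #|vertex N n| = setT.
  by apply/eqP; rewrite eqEcard subsetT cardsT (card_chain cw) /=.
have nT : set0 != [set: vertex N n].
  by rewrite eq_sym -subset0; apply/subsetPn; exists v0; rewrite !inE.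
have negT : H (w #|vertex N n|) < H (w 0%N) by rewrite wT w0E Hfull.
have negE : exists m, H (w m) < H (w 0%N) by exists #|vertex N n|.
case: (ex_minnP negE) => m0 m0_neg m0_le.
have m0_min b : (b < m0)%N -> H (w 0%N) <= H (w b).
  by rewrite leNgt; apply: contraTN => /m0_le; rewrite -leqNgt.
have m0T : (m0 <= #|{: vertex N n}|)%N by apply: m0_le.
have m01 : (1 <= m0)%N by case: (m0) m0_neg => //; rewrite ltxx.
(* [H (w a)] serves as [G]; being attained at size [a], it is also a level that [barrier] forces on
   every path. *)
have [a _ amax] := arg_maxP (P := xpredT) (fun i : 'I_m0.+1 => H (w i)) (i0 := ord0) isT.
have Gmax b : (b <= m0)%N -> H (w b) <= H (w a).
  by move=> bm; exact: (amax (Ordinal (bm : (b < m0.+1)%N)) isT).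
have Ggt : H (w 0%N) < H (w a) by rewrite w0E; apply: lt_le_trans H01 (Gmax _ m01).
have lower : H (w a) - H set0 <= stab_level J h (boxminus N n).
  apply: stab_level_ge; first exact: ham_le_Hmax.
  by move=> t c ts; apply: (barrier cw m0T m0_min _ Ggt ts); rewrite -ltnS.
have upper (s : config N n) : s != set0 -> s != setT -> stab_level J h s < H (w a) - H set0.
  move=> s0 sT.
  have [||t ts st] := escape (f := H) _ _ chains cw m0T m0_neg m0_min Gmax Ggt s0 sT.
  - by move=> A B; apply: ham_submod.
  - by move=> A B; apply: ham_submod_strict.
  have := stab_level_lt ts _ st; rewrite w0E in Ggt *.
  by rewrite ltrDl subr_gt0 => /(_ Ggt); rewrite [X in _ < X - _]addrC addrK.
have stabE (s : config N n) : (s \in Omega_stab N n J h) = (s == setT).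
  rewrite inE; apply/forallP/eqP => [hs|-> t].
    by apply/eqP; apply: contraTT (hs setT) => sT; rewrite -ltNge; apply: Hfull.
  by have [->|tT] := eqVneq t setT; [exact: lexx|apply/ltW/Hfull].
apply/setP => s; rewrite [in RHS]inE [in LHS]inE stabE; apply/idP/eqP => [/andP[sT /forallP]|->].
  move=> /(_ (boxminus N n)); rewrite stabE nT /= => ge.
  apply/eqP; apply: contraLR ge => s0; rewrite -ltNge.
  by apply: lt_le_trans (upper s s0 sT) lower.
rewrite nT; apply/forallP => t; apply/implyP; rewrite stabE => tT.
have [->|t0] := eqVneq t (boxminus N n); first exact: lexx.
exact/ltW/(lt_le_trans (upper t t0 tT) lower).
Qed.
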